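(* Fix a real number $q>1$. For an odd prime $p\ge5$ let $x_p(q)$ be a real zero of $\mathfrak F(\cdot,q)$ in $(p-1,p)$ (at least one exists), put $\Delta_p(q):=p-x_p(q)$, and define $$K(q,p):=\frac12\left(\sum_{i\ge2}q^{-i}\,\phi_i''(p)-q^{-p}(\log q)^2\right).$$ Then, as $p\to\infty$ through primes, $$\Delta_p(q)=\frac{\log q}{K(q,p)}\,q^{-p}\,\bigl(1+O(q^{-p})\bigr),$$ uniformly in $p$, with implied constants depending only on $q$. In particular, $\Delta_p(q)\asymp q^{-p}$, and $x_p(q)=p-\Delta_p(q)$ lies strictly to the left of $p$.
   Context: For $z\in\mathbb C$ and an integer $i\ge2$, $F(z,i)=i+2\sum_{k=1}^{i-1}(i-k)\cos(2\pi kz/i)$ and $\phi_i(z)=F(z,i)/i^2$. For $q>1$, $$\mathfrak F(z,q)=(q-1)q\left(\sum_{i=2}^{\infty}q^{-i}\phi_i(z)-q^{-z}\right),$$ where $q^{-z}=e^{-z\log q}$ with the real logarithm. The notation $\Delta_p(q)\asymp q^{-p}$ means bounded above and below by positive constant multiples (depending only on $q$) of $q^{-p}$. *)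

(* Defs.v *)
(* Standard-library real numbers, with Coquelicot for complex numbers, series
   and complex derivatives. *)
From Stdlib Require Import Reals ZArith Znumtheory.
From Coquelicot Require Import Coquelicot.
Open Scope R_scope.

Definition Cexp (z : C) : C := (exp (Re z) * cos (Im z), exp (Re z) * sin (Im z)).

Definition Ccos (z : C) : C := ((Cexp (Ci * z) + Cexp (- (Ci * z))) / 2)%C.

(* Coquelicot has the total operator [Series] for real series only. *)
Definition CSeries (u : nat -> C) : C :=
  (Series (fun n => Re (u n)), Series (fun n => Im (u n))).

Lemma is_series_CSeries (u : nat -> C) (l : C) :
  is_series (V := C_R_NormedModule) u l -> CSeries u = l.
Proof.
intros Hu; destruct l as [a b]; unfold CSeries; f_equal; apply is_series_unique;
  unfold is_series in *.
- eapply filterlim_ext; [| exact (filterlim_comp _ _ _ _ fst _ _ _ Hu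
    (continuous_fst (U := R_UniformSpace) (V := R_UniformSpace) a b))].
  intros n; cbv beta; induction n as [|n IH].
  + now rewrite !sum_O.
  + now rewrite !sum_Sn, <- IH.
- eapply filterlim_ext; [| exact (filterlim_comp _ _ _ _ snd _ _ _ Hu
    (continuous_snd (U := R_UniformSpace) (V := R_UniformSpace) a b))].
  intros n; cbv beta; induction n as [|n IH].
  + now rewrite !sum_O.
  + now rewrite !sum_Sn, <- IH.
Qed.

(* F(z,i) and phi_i(z); only the values at i >= 2 are meaningful. *)
Definition Fejer (z : C) (i : nat) : C :=
  (INR i + 2 * sum_n_m (fun k : nat =>
     (INR (i - k) * Ccos (2 * PI * INR k * z / INR i))%C) 1 (i - 1))%C.

Definition phi (i : nat) (z : C) : C := (Fejer z i / (INR i * INR i))%C.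

Definition phi'' (i : nat) (z : C) : C := C_derive (C_derive (phi i)) z.

(* q^{-z}, for a real base q > 0 *)
Definition Cpow_opp (q : R) (z : C) : C := Cexp (- z * ln q)%C.

(* The sums over i >= 2 are reindexed by i = n + 2. *)
Definition frakF (z : C) (q : R) : C :=
  ((q - 1) * q *
   (CSeries (fun n => RtoC (/ q ^ (n + 2)) * phi (n + 2) z) - Cpow_opp q z))%C.

(* K(q,p) as a complex number, since the phi_i are functions on C. *)
Definition K (q : R) (p : nat) : C :=
  (/ 2 * (CSeries (fun n => RtoC (/ q ^ (n + 2)) * phi'' (n + 2) (INR p))
          - RtoC (/ q ^ p * (ln q) ^ 2)))%C.

Definition prime_ge5 (p : nat) : Prop := prime (Z.of_nat p) /\ (5 <= p)%nat.

Definition Delta_p (p : nat) (x : R) : R := INR p - x.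

Definition left_zero (q : R) (p : nat) (x : R) : Prop :=
  INR p - 1 < x < INR p /\ frakF (RtoC x) q = RtoC 0.

(* Main.v *)
Require Import Defs.
From Stdlib Require Import Reals ZArith Znumtheory Lra Lia.
From Coquelicot Require Import Coquelicot.
Open Scope R_scope.

(** On the real line phi_i is the square (sin (PI x) / (i sin (PI x / i)))^2,
    with value 1 where the denominator vanishes.  So it is nonnegative, and at an
    integer n it equals 1 if i divides n and 0 otherwise.  In both cases n is an
    extremum, whence phi_i'(n) = 0.  The real function studied is gap(x), the sum of
    q^(-i) phi_i(x) minus q^(-x); up to the positive factor (q - 1) q it is the
    restriction of frakF to R.

    Let p >= 5 be prime.  Only i = p divides p, so the sum at p equals
    E = q^(-p) and p itself is a zero of gap.  The derivatives of phi_i up to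
    order three are bounded uniformly in i and x, so the Taylor expansion at p
    can be summed over i ([gap_expansion]).  With L = log q it reads

      gap(p - h) = K h^2 - E L h + O(h^3),

    with a constant that depends on q only.  For small h > 0 this is negative,
    whereas gap(p - 1) > 0 since both 2 and p - 1 divide p - 1; continuity gives a
    zero in (p - 1, p).

    For a zero p - h, the expansion without the exact value of the quadratic
    coefficient gives E L h <= O(h^2), that is h >= c1 E ([gap_upper]).  The
    reverse bound must hold for every zero of the interval, including those for
    which h is not known to be small.  It follows from two terms of the sum: the
    term i = 2 is at least q^(-2) h^2 / 4, while the term i = p differs from
    E by O(E h^2) and q^(-(p - h)) differs from E by O(E h); comparing, h = O(E)
    ([zero_upper]).  Division of the expansion by h then gives
    |K h - E L| = O(h^2) = O(E^2) ([zero_second_order]), which is the claimed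
    asymptotic formula as soon as K <> 0.

    K is in fact positive ([K_re_pos]).  For i other than p the point p is a
    minimum of phi_i, so phi_i''(p) >= 0; the values PI^2/2 for i = 2 and
    8 PI^2/27 for i = 3 outweigh phi_p''(p) >= -2 PI^2/3 and the term
    -E L^2. *)

(** * Elementary Taylor estimates *)

Lemma increasing_from_0 (f df : R -> R) (x : R) :
  0 <= x -> (forall t, 0 <= t <= x -> is_derive f t (df t)) ->
  (forall t, 0 <= t <= x -> 0 <= df t) -> f 0 <= f x.
Proof.
intros Hx Hd Hpos.
destruct (Rle_lt_or_eq_dec _ _ Hx) as [Hx'|<-]; [| lra].
destruct (MVT_cor2 f df 0 x Hx') as [c [Hc Hc']].
{ intros c Hc; apply is_derive_Reals, Hd, Hc. }
assert (0 <= df c) by (apply Hpos; lra).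
assert (0 <= df c * (x - 0)) by (apply Rmult_le_pos; lra). lra.
Qed.

Lemma sin_between_id (x : R) : 0 <= x -> - x <= sin x <= x.
Proof.
intros Hx; split.
- pose proof (increasing_from_0 (fun t => sin t + t) (fun t => cos t + 1) x Hx) as H.
  cbv beta in H; rewrite sin_0 in H.
  enough (0 + 0 <= sin x + x) by lra. apply H.
  + intros s _; auto_derive; [easy | ring].
  + intros s _; generalize (COS_bound s); lra.
- pose proof (increasing_from_0 (fun t => t - sin t) (fun t => 1 - cos t) x Hx) as H.
  cbv beta in H; rewrite sin_0 in H.
  enough (0 - 0 <= x - sin x) by lra. apply H.
  + intros s _; auto_derive; [easy | ring].
  + intros s _; generalize (COS_bound s); lra.
Qed.

(** Integrating 1 - cos t >= 0 repeatedly from 0 yields the successive partial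
    sums of the sine and cosine series as bounds. *)
Lemma sin_lower_cubic (x : R) : 0 <= x -> x - x ^ 3 / 6 <= sin x.
Proof.
intros Hx.
assert (Hcos : forall t, 0 <= t -> 1 - t ^ 2 / 2 <= cos t).
{ intros t Ht.
  pose proof (increasing_from_0 (fun t => cos t - (1 - t ^ 2 / 2))
    (fun t => t - sin t) t Ht) as H.
  cbv beta in H; rewrite cos_0 in H.
  enough (1 - (1 - 0 ^ 2 / 2) <= cos t - (1 - t ^ 2 / 2)) by lra. apply H.
  - intros s _; auto_derive; [easy | field].
  - intros s Hs; generalize (sin_between_id s); lra. }
pose proof (increasing_from_0 (fun t => sin t - (t - t ^ 3 / 6))
  (fun t => cos t - (1 - t ^ 2 / 2)) x Hx) as H.
cbv beta in H; rewrite sin_0 in H.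
enough (0 - (0 - 0 ^ 3 / 6) <= sin x - (x - x ^ 3 / 6)) by lra. apply H.
- intros s _; auto_derive; [easy | field].
- intros s Hs; generalize (Hcos s); lra.
Qed.

Lemma sin_taylor (x : R) :
  Rabs (sin x) <= Rabs x /\ Rabs (sin x - x) <= Rabs x ^ 3 / 6.
Proof.
assert (Hpos : forall t, 0 <= t -> Rabs (sin t) <= t /\ Rabs (sin t - t) <= t ^ 3 / 6).
{ intros t Ht; pose proof (sin_lower_cubic t Ht); pose proof (sin_between_id t Ht).
  assert (0 <= t ^ 3) by now apply pow_le.
  split; apply Rabs_le; lra. }
destruct (Rle_dec 0 x) as [Hx|Hx].
- rewrite (Rabs_pos_eq x) by easy; now apply Hpos.
- rewrite (Rabs_left x) by lra.
  replace (sin x - x) with (- (sin (- x) - - x)) by (rewrite sin_neg; ring).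
  rewrite <- (Rabs_Ropp (sin x)), <- sin_neg, Rabs_Ropp; apply Hpos; lra.
Qed.

Lemma cos_taylor (x : R) : Rabs (cos x - 1 + x ^ 2 / 2) <= Rabs x ^ 3 / 2.
Proof.
set (t := x / 2).
replace x with (2 * t) by (unfold t; field).
rewrite cos_2a_sin, Rabs_mult, (Rabs_pos_eq 2) by lra.
replace (1 - 2 * sin t * sin t - 1 + (2 * t) ^ 2 / 2)
  with (- (2 * ((sin t - t) * (sin t + t)))) by field.
rewrite Rabs_Ropp, 2!Rabs_mult, (Rabs_pos_eq 2) by lra.
destruct (sin_taylor t) as [Hl Hc].
pose proof (Rabs_triang (sin t) t). pose proof (Rabs_triang (sin t) (- t)) as H'.
rewrite Rabs_Ropp in H'; fold (sin t - t) in H'.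
pose proof (Rabs_pos t). set (u := Rabs t) in *.
assert (Hb : Rabs (sin t - t) <= u ^ 2).
{ (* the cubic bound for small t, the linear one for large t *)
  destruct (Rle_dec u 6); nra. }
assert (Rabs (sin t - t) * Rabs (sin t + t) <= u ^ 2 * (2 * u)).
{ apply Rmult_le_compat; try apply Rabs_pos; lra. }
lra.
Qed.

(** The estimates of orders one and two are integrated in turn; at each stage
    exp t is replaced by the constant exp x at the right end of the interval. *)
Lemma exp_taylor (x : R) : 0 <= x ->
  0 <= exp x - 1 - x - x ^ 2 / 2 <= x ^ 3 * exp x.
Proof.
intros Hx.
assert (H1 : forall t, 0 <= t <= x -> 0 <= exp t - 1 <= t * exp x).
{ intros t Ht; split; [generalize (exp_ineq1_le t); lra|].
  pose proof (exp_ineq1_le (- t)). pose proof (exp_pos t).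
  assert (exp t <= exp x).
  { destruct (Rle_lt_or_eq_dec t x (proj2 Ht)) as [h| ->]; [left; now apply exp_increasing|lra]. }
  assert (exp t * exp (- t) = 1) by (rewrite <- exp_plus, Rplus_opp_r; apply exp_0).
  nra. }
assert (H2 : forall t, 0 <= t <= x -> 0 <= exp t - 1 - t <= t ^ 2 * exp x).
{ intros t Ht; split; [generalize (exp_ineq1_le t); lra|].
  pose proof (increasing_from_0 (fun t => t ^ 2 * exp x - (exp t - 1 - t))
    (fun t => 2 * t * exp x - (exp t - 1)) t (proj1 Ht)) as H.
  cbv beta in H; rewrite exp_0 in H.
  enough (0 ^ 2 * exp x - (1 - 1 - 0) <= t ^ 2 * exp x - (exp t - 1 - t)) by lra.
  apply H.
  - intros s _; auto_derive; [easy | ring].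
  - intros s Hs; pose proof (H1 s). pose proof (exp_pos x).
    assert (0 <= s * exp x) by (apply Rmult_le_pos; lra). lra. }
split.
- pose proof (increasing_from_0 (fun t => exp t - 1 - t - t ^ 2 / 2)
    (fun t => exp t - 1 - t) x Hx) as H.
  cbv beta in H; rewrite exp_0 in H.
  enough (1 - 1 - 0 - 0 ^ 2 / 2 <= exp x - 1 - x - x ^ 2 / 2) by lra. apply H.
  + intros s _; auto_derive; [easy | field].
  + intros s Hs; now apply H2.
- pose proof (increasing_from_0 (fun t => t ^ 3 * exp x - (exp t - 1 - t - t ^ 2 / 2))
    (fun t => 3 * t ^ 2 * exp x - (exp t - 1 - t)) x Hx) as H.
  cbv beta in H; rewrite exp_0 in H.
  enough (0 ^ 3 * exp x - (1 - 1 - 0 - 0 ^ 2 / 2)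
    <= x ^ 3 * exp x - (exp x - 1 - x - x ^ 2 / 2)) by lra.
  apply H.
  + intros s _; auto_derive; [easy | field].
  + intros s Hs; pose proof (H2 s Hs).
    assert (0 <= s ^ 2 * exp x).
    { apply Rmult_le_pos; [apply pow2_ge_0 | left; apply exp_pos]. } lra.
Qed.

Lemma cos_shift_taylor (a h : R) :
  Rabs (cos (a - h) - cos a - h * sin a + h ^ 2 / 2 * cos a) <= Rabs h ^ 3.
Proof.
rewrite cos_minus.
replace (cos a * cos h + sin a * sin h - cos a - h * sin a + h ^ 2 / 2 * cos a)
  with (cos a * (cos h - 1 + h ^ 2 / 2) + sin a * (sin h - h)) by ring.
eapply Rle_trans; [apply Rabs_triang|]. rewrite 2!Rabs_mult.
pose proof (cos_taylor h). pose proof (proj2 (sin_taylor h)).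
assert (Rabs (cos a) <= 1) by (apply Rabs_le, COS_bound).
assert (Rabs (sin a) <= 1) by (apply Rabs_le, SIN_bound).
assert (0 <= Rabs h ^ 3) by apply pow_le, Rabs_pos.
pose proof (Rabs_pos (cos a)). pose proof (Rabs_pos (sin a)).
pose proof (Rabs_pos (cos h - 1 + h ^ 2 / 2)). pose proof (Rabs_pos (sin h - h)).
nra.
Qed.

Lemma limit_le_0 (a B : R) : (forall t, 0 < t <= 1 -> a <= B * t) -> a <= 0.
Proof.
intros H; destruct (Rle_dec a 0) as [|Ha]; [easy|].
pose proof (Rabs_pos B). pose proof (Rle_abs B).
assert (Hd : 0 < a + Rabs B + 1) by lra.
(* At t = a / (a + |B| + 1) one has B t < a if a > 0. *)
assert (Ht : 0 < a / (a + Rabs B + 1) <= 1).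
{ split; [apply Rdiv_lt_0_compat; lra|]. apply Rle_div_l; lra. }
specialize (H _ Ht).
assert (B * (a / (a + Rabs B + 1)) < a); [| lra].
unfold Rdiv; rewrite <- Rmult_assoc; apply Rlt_div_l; [lra | nra].
Qed.

(** The first and second order conditions at a minimum, read off from a Taylor
    expansion with cubic remainder. *)
Lemma cubic_perturbation_nonneg (a b C : R) :
  (forall h, 0 <= a * h + b * h ^ 2 + C * Rabs h ^ 3) -> a = 0 /\ 0 <= b.
Proof.
intros H.
assert (Hslope : forall c,
  (forall t, 0 < t <= 1 -> 0 <= c * t + b * t ^ 2 + C * t ^ 3) -> - c <= 0).
{ intros c Hc; apply (limit_le_0 (- c) (Rabs b + Rabs C)); intros t Ht.
  specialize (Hc t Ht).
  pose proof (Rle_abs b); pose proof (Rle_abs C); pose proof (Rabs_pos C).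
  apply Rmult_le_reg_r with t; [lra|].
  assert (b * t ^ 2 <= Rabs b * t ^ 2) by (apply Rmult_le_compat_r; nra).
  assert (C * t ^ 3 <= Rabs C * t ^ 2).
  { assert (t ^ 3 <= t ^ 2) by nra. assert (0 <= t ^ 3) by (apply pow_le; lra). nra. }
  nra. }
assert (Ha : a = 0).
{ assert (- a <= 0).
  { apply Hslope; intros t Ht. specialize (H t).
    rewrite Rabs_pos_eq in H by lra. lra. }
  assert (- - a <= 0); [| lra].
  apply Hslope; intros t Ht. specialize (H (- t)).
  rewrite Rabs_Ropp, Rabs_pos_eq in H by lra. lra. }
split; [easy|]. subst a.
enough (- b <= 0) by lra. apply (limit_le_0 (- b) C); intros t Ht.
specialize (H t). rewrite Rabs_pos_eq in H by lra.
apply Rmult_le_reg_r with (t ^ 2); [apply pow_lt; lra | lra].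
Qed.

(** * Weighted cosine sums and the kernels on the real line *)

(* Makes the type of an equation between finite sums syntactically R, as [ring] requires. *)
Ltac real_eq := match goal with |- ?a = ?b => change (@eq R a b) end.

Lemma sum_R_ext (u v : nat -> R) (n m : nat) :
  (forall k, (n <= k <= m)%nat -> u k = v k) -> sum_n_m u n m = sum_n_m v n m.
Proof. exact (sum_n_m_ext_loc u v n m). Qed.

Lemma sum_R_plus (u v : nat -> R) (n m : nat) :
  sum_n_m (fun k => u k + v k) n m = sum_n_m u n m + sum_n_m v n m.
Proof. exact (sum_n_m_plus u v n m). Qed.

Lemma sum_R_scal (a : R) (u : nat -> R) (n m : nat) :
  sum_n_m (fun k => a * u k) n m = a * sum_n_m u n m.
Proof. exact (sum_n_m_mult_l (K := R_Ring) a u n m). Qed.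

Lemma sum_R_empty (u : nat -> R) : sum_n_m u 1 0 = 0.
Proof. apply (sum_n_m_zero u); lia. Qed.

Lemma sum_R_last (u : nat -> R) (n : nat) :
  sum_n_m u 1 (S n) = sum_n_m u 1 n + u (S n).
Proof. apply (sum_n_Sm u); lia. Qed.

(** phi_i is a trigonometric polynomial with frequencies 2 PI k / i; all of them
    are at most 2 PI, which is why the bounds below do not depend on i. *)
Definition freq (i k : nat) : R := 2 * PI * INR k / INR i.

Definition fejer_sum (i : nat) (f : nat -> R) : R :=
  2 * sum_n_m (fun k => INR (i - k) * f k) 1 (i - 1) / (INR i * INR i).

(** The restriction of phi_i to the real line ([phi_real]); [phiR'] and [phiR'']
    are its derivatives. *)
Definition phiR (i : nat) (x : R) : R :=
  / INR i + fejer_sum i (fun k => cos (freq i k * x)).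

Definition phiR' (i : nat) (x : R) : R :=
  - fejer_sum i (fun k => freq i k * sin (freq i k * x)).

Definition phiR'' (i : nat) (x : R) : R :=
  - fejer_sum i (fun k => freq i k ^ 2 * cos (freq i k * x)).

Lemma INR_ge2_pos (i : nat) : (2 <= i)%nat -> 0 < INR i.
Proof. intros Hi; apply lt_0_INR; lia. Qed.

Lemma fejer_sum_ext (i : nat) (f g : nat -> R) :
  (forall k, (1 <= k <= i - 1)%nat -> f k = g k) -> fejer_sum i f = fejer_sum i g.
Proof.
intros H; unfold fejer_sum; f_equal; f_equal; apply sum_R_ext.
intros k Hk; now rewrite H.
Qed.

Lemma fejer_sum_lin (i : nat) (a b : R) (f g : nat -> R) :
  fejer_sum i (fun k => a * f k + b * g k) = a * fejer_sum i f + b * fejer_sum i g.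
Proof.
unfold fejer_sum.
rewrite (sum_R_ext _
  (fun k => a * (INR (i - k) * f k) + b * (INR (i - k) * g k))) by (intros; ring).
rewrite sum_R_plus, 2!sum_R_scal. unfold Rdiv; ring.
Qed.

(** The weights 2 (i - k) / i^2 have total mass at most 2, whatever i. *)
Lemma fejer_sum_abs_le (i : nat) (B : R) (f : nat -> R) :
  (2 <= i)%nat -> 0 <= B ->
  (forall k, (1 <= k <= i - 1)%nat -> Rabs (f k) <= B) -> Rabs (fejer_sum i f) <= 2 * B.
Proof.
intros Hi HB H; pose proof (INR_ge2_pos i Hi) as Hi0.
unfold fejer_sum; unfold Rdiv; rewrite 2!Rabs_mult, (Rabs_pos_eq 2), (Rabs_pos_eq (/ _)) by
  (try (left; apply Rinv_0_lt_compat); nra).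
assert (Hs : Rabs (sum_n_m (fun k => INR (i - k) * f k) 1 (i - 1)) <= INR i * (INR i * B)).
{ eapply Rle_trans; [apply (norm_sum_n_m (K := R_AbsRing) (V := R_NormedModule))|].
  rewrite (sum_R_ext _ (fun k =>
    if (Nat.leb 1 k && Nat.leb k (i - 1))%bool then Rabs (INR (i - k) * f k) else 0)).
  2:{ intros k [Hk1 Hk2]; apply Nat.leb_le in Hk1, Hk2; now rewrite Hk1, Hk2. }
  apply Rle_trans with (sum_n_m (fun _ => INR i * B) 1 (i - 1)).
  - apply sum_n_m_le; intros k.
    destruct (Nat.leb_spec 1 k); [destruct (Nat.leb_spec k (i - 1))|]; simpl; try nra.
    rewrite Rabs_mult, Rabs_pos_eq by apply pos_INR.
    apply Rmult_le_compat; try apply pos_INR; try apply Rabs_pos.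
    + apply le_INR; lia.
    + apply H; lia.
  - rewrite sum_n_m_const; apply Rmult_le_compat_r; [nra|]; apply le_INR; lia. }
apply Rle_trans with (2 * (INR i * (INR i * B)) * / (INR i * INR i)).
- apply Rmult_le_compat_r; [left; apply Rinv_0_lt_compat; nra | lra].
- right; field; lra.
Qed.

(** Bounds phi_i, phi_i', phi_i'' and the cubic Taylor remainder at the same
    time: a mode of frequency at most 2 PI contributes at most (2 PI)^3 |h|^3 to the
    remainder, and the total mass of the modes is at most 2. *)
Definition taylor_const : R := 2 * (2 * PI) ^ 3.

Lemma taylor_const_bounds :
  2 * (2 * PI) <= taylor_const /\ 2 * (2 * PI) ^ 2 <= taylor_const /\ 1 <= taylor_const.
Proof. unfold taylor_const; pose proof PI2_3_2; simpl; nra. Qed.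

Lemma freq_bound (i k : nat) : (1 <= k <= i - 1)%nat -> 0 <= freq i k <= 2 * PI.
Proof.
intros Hk; pose proof PI_RGT_0. assert (0 < INR i) by (apply INR_ge2_pos; lia).
unfold freq; split.
- apply Rmult_le_pos; [apply Rmult_le_pos; [lra | apply pos_INR] |].
  left; now apply Rinv_0_lt_compat.
- apply Rle_div_l; [easy|]. apply Rmult_le_compat_l; [lra|]. apply le_INR; lia.
Qed.

Lemma phiR_bound (i : nat) (x : R) : (2 <= i)%nat -> Rabs (phiR i x) <= taylor_const.
Proof.
intros Hi; pose proof (INR_ge2_pos i Hi) as Hi0. pose proof PI2_3_2.
assert (Hc : Rabs (fejer_sum i (fun k => cos (freq i k * x))) <= 2 * 1).
{ apply fejer_sum_abs_le; [easy | lra |]. intros; apply Rabs_le, COS_bound. }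
assert (Hinv : 0 <= / INR i <= 1).
{ split; [left; now apply Rinv_0_lt_compat|]. rewrite <- Rinv_1.
  apply Rinv_le_contravar; [lra|]. apply (le_INR 1); lia. }
unfold phiR; apply Rabs_le_between in Hc. pose proof taylor_const_bounds.
apply Rabs_le; lra.
Qed.

Lemma phiR'_bound (i : nat) (x : R) : (2 <= i)%nat -> Rabs (phiR' i x) <= taylor_const.
Proof.
intros Hi; unfold phiR'; rewrite Rabs_Ropp. pose proof PI_RGT_0.
eapply Rle_trans; [apply fejer_sum_abs_le with (B := 2 * PI)|];
  [easy | lra | | apply taylor_const_bounds].
intros k Hk; pose proof (freq_bound i k Hk).
rewrite Rabs_mult, Rabs_pos_eq by lra.
assert (Rabs (sin (freq i k * x)) <= 1) by (apply Rabs_le, SIN_bound).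
pose proof (Rabs_pos (sin (freq i k * x))). nra.
Qed.

Lemma phiR''_bound (i : nat) (x : R) : (2 <= i)%nat -> Rabs (phiR'' i x) <= taylor_const.
Proof.
intros Hi; unfold phiR''; rewrite Rabs_Ropp. pose proof PI_RGT_0.
eapply Rle_trans; [apply fejer_sum_abs_le with (B := (2 * PI) ^ 2)|];
  [easy | apply pow2_ge_0 | | apply taylor_const_bounds].
intros k Hk; pose proof (freq_bound i k Hk) as Hf.
rewrite Rabs_mult, Rabs_pos_eq by apply pow2_ge_0.
assert (Rabs (cos (freq i k * x)) <= 1) by (apply Rabs_le, COS_bound).
pose proof (Rabs_pos (cos (freq i k * x))).
assert (freq i k ^ 2 <= (2 * PI) ^ 2) by now apply pow_incr.
pose proof (pow2_ge_0 (freq i k)). nra.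
Qed.

Lemma phiR_taylor (i : nat) (x h : R) : (2 <= i)%nat ->
  Rabs (phiR i (x - h) - phiR i x + h * phiR' i x - h ^ 2 / 2 * phiR'' i x)
    <= taylor_const * Rabs h ^ 3.
Proof.
intros Hi. pose proof PI_RGT_0.
replace (phiR i (x - h) - phiR i x + h * phiR' i x - h ^ 2 / 2 * phiR'' i x)
  with (fejer_sum i (fun k => cos (freq i k * x - freq i k * h) - cos (freq i k * x)
    - freq i k * h * sin (freq i k * x) + (freq i k * h) ^ 2 / 2 * cos (freq i k * x))).
- replace (taylor_const * Rabs h ^ 3) with (2 * ((2 * PI * Rabs h) ^ 3))
    by (unfold taylor_const; ring).
  assert (0 <= 2 * PI * Rabs h) by (pose proof (Rabs_pos h); nra).
  apply fejer_sum_abs_le; [easy | now apply pow_le |]. intros k Hk.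
  eapply Rle_trans; [apply cos_shift_taylor|].
  pose proof (freq_bound i k Hk). apply pow_incr; split; [apply Rabs_pos|].
  rewrite Rabs_mult, Rabs_pos_eq by lra.
  apply Rmult_le_compat_r; [apply Rabs_pos | lra].
- unfold phiR, phiR', phiR''.
  set (f0 := fun k => cos (freq i k * (x - h))).
  set (f1 := fun k => cos (freq i k * x)).
  set (f2 := fun k => freq i k * sin (freq i k * x)).
  set (f3 := fun k => freq i k ^ 2 * cos (freq i k * x)).
  transitivity (fejer_sum i (fun k => 1 * (1 * f0 k + (-1) * f1 k)
    + 1 * ((- h) * f2 k + (h ^ 2 / 2) * f3 k))).
  + apply fejer_sum_ext; intros k _; unfold f0, f1, f2, f3.
    rewrite Rmult_minus_distr_l. field.
  + rewrite 3!fejer_sum_lin. ring.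
Qed.

(** * Closed form of the kernel and its values at the integers *)

(** Multiplication by 1 - cos t makes the cosine sum telescope. *)
Lemma dirichlet_closed_form (t : R) (n : nat) :
  (1 - cos t) * (1 + 2 * sum_n_m (fun k => cos (INR k * t)) 1 n)
  = cos (INR n * t) - cos (INR (S n) * t).
Proof.
induction n as [|n IH].
- rewrite sum_R_empty. simpl. rewrite Rmult_0_l, cos_0, Rmult_1_l. ring.
- rewrite sum_R_last.
  replace ((1 - cos t) * (1 + 2 * (sum_n_m (fun k => cos (INR k * t)) 1 n + cos (INR (S n) * t))))
    with ((1 - cos t) * (1 + 2 * sum_n_m (fun k => cos (INR k * t)) 1 n)
      + (1 - cos t) * (2 * cos (INR (S n) * t))) by ring.
  rewrite IH, (S_INR (S n)), S_INR.
  replace ((INR n + 1 + 1) * t) with ((INR n + 1) * t + t) by ring.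
  replace (INR n * t) with ((INR n + 1) * t - t) by ring.
  rewrite cos_plus, cos_minus. ring.
Qed.

Lemma fejer_step (c : nat -> R) (n : nat) :
  sum_n_m (fun k => INR (S (S n) - k) * c k) 1 (S n)
  = sum_n_m (fun k => INR (S n - k) * c k) 1 n + sum_n_m c 1 (S n) :> R.
Proof.
rewrite 2!sum_R_last.
replace (S (S n) - S n)%nat with 1%nat by lia. simpl (INR 1).
rewrite (sum_R_ext _ (fun k => INR (S n - k) * c k + c k)).
- rewrite sum_R_plus. real_eq. ring.
- intros k Hk. replace (S (S n) - k)%nat with (S (S n - k)) by lia.
  rewrite S_INR. ring.
Qed.

(** The Fejer kernel of order n + 1 is the sum of the Dirichlet kernels of order
    at most n, so the differences of [dirichlet_closed_form] telescope once more. *)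
Lemma fejer_closed_form (t : R) (n : nat) :
  (1 - cos t) * (INR (S n) + 2 * sum_n_m (fun k => INR (S n - k) * cos (INR k * t)) 1 n)
  = 1 - cos (INR (S n) * t).
Proof.
induction n as [|n IH].
- rewrite sum_R_empty. simpl. rewrite Rmult_1_l. ring.
- rewrite fejer_step.
  pose proof (dirichlet_closed_form t (S n)) as HD.
  rewrite (S_INR (S n)) at 1.
  replace ((1 - cos t) * (INR (S n) + 1
      + 2 * (sum_n_m (fun k => INR (S n - k) * cos (INR k * t)) 1 n
      + sum_n_m (fun k => cos (INR k * t)) 1 (S n))))
    with ((1 - cos t) * (INR (S n) + 2 * sum_n_m (fun k => INR (S n - k) * cos (INR k * t)) 1 n)
      + (1 - cos t) * (1 + 2 * sum_n_m (fun k => cos (INR k * t)) 1 (S n))) by ring.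
  rewrite IH, HD. ring.
Qed.

Lemma cos_sin_multiple (t : R) (n : nat) :
  cos t = 1 -> cos (INR n * t) = 1 /\ sin (INR n * t) = 0.
Proof.
intros Ht.
assert (Hs : sin t = 0) by (pose proof (sin2_cos2 t) as H; unfold Rsqr in H; nra).
induction n as [|n [IHc IHs]].
- simpl; rewrite Rmult_0_l, cos_0, sin_0; easy.
- rewrite S_INR, Rmult_plus_distr_r, Rmult_1_l, cos_plus, sin_plus, IHc, IHs, Ht, Hs.
  split; ring.
Qed.

Lemma sum_weights (n : nat) :
  INR (S n) + 2 * sum_n_m (fun k => INR (S n - k) * 1) 1 n = INR (S n) * INR (S n).
Proof.
induction n as [|n IH].
- rewrite sum_R_empty. simpl; ring.
- rewrite (fejer_step (fun _ => 1)).
  rewrite sum_n_m_const. replace (S (S n) - 1)%nat with (S n) by lia.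
  rewrite (S_INR (S n)). lra.
Qed.

Lemma freq_mul (i k : nat) (x : R) : freq i k * x = INR k * (freq i 1 * x).
Proof. unfold freq, Rdiv; simpl; ring. Qed.

Lemma freq_full (i : nat) (x : R) : (2 <= i)%nat -> INR i * (freq i 1 * x) = 2 * PI * x.
Proof. intros Hi; pose proof (INR_ge2_pos i Hi); unfold freq; simpl; field; lra. Qed.

Lemma phiR_fejer (i : nat) (x : R) : (2 <= i)%nat ->
  phiR i x = (INR i + 2 * sum_n_m (fun k => INR (i - k) * cos (INR k * (freq i 1 * x))) 1 (i - 1))
    / (INR i * INR i).
Proof.
intros Hi; pose proof (INR_ge2_pos i Hi); unfold phiR.
rewrite (fejer_sum_ext i _ (fun k => cos (INR k * (freq i 1 * x))))
  by (intros; now rewrite freq_mul).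
unfold fejer_sum. field; lra.
Qed.

Lemma phiR_eq_1 (i : nat) (x : R) : (2 <= i)%nat ->
  cos (freq i 1 * x) = 1 -> phiR i x = 1.
Proof.
intros Hi Hc; pose proof (INR_ge2_pos i Hi); rewrite phiR_fejer by easy.
rewrite (sum_R_ext _ (fun k => INR (i - k) * 1))
  by (intros k _; now rewrite (proj1 (cos_sin_multiple _ k Hc))).
destruct i as [|i]; [lia|]. replace (S i - 1)%nat with i by lia.
rewrite sum_weights. field; lra.
Qed.

Lemma phiR_closed_form (i : nat) (x : R) : (2 <= i)%nat ->
  (1 - cos (freq i 1 * x)) * phiR i x = (1 - cos (2 * PI * x)) / (INR i * INR i).
Proof.
intros Hi; pose proof (INR_ge2_pos i Hi); rewrite phiR_fejer by easy.
rewrite <- (freq_full i x Hi).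
destruct i as [|i]; [lia|].
rewrite <- (fejer_closed_form (freq (S i) 1 * x) i).
replace (S i - 1)%nat with i by lia. field; lra.
Qed.

(** Where cos (2 PI x / i) <> 1 the closed form is a quotient of nonnegative
    numbers; elsewhere phi_i(x) = 1. *)
Lemma phiR_nonneg (i : nat) (x : R) : (2 <= i)%nat -> 0 <= phiR i x.
Proof.
intros Hi; pose proof (INR_ge2_pos i Hi).
destruct (Req_dec (cos (freq i 1 * x)) 1) as [Hc|Hc].
- rewrite phiR_eq_1; lra || easy.
- pose proof (phiR_closed_form i x Hi) as H1.
  pose proof (COS_bound (freq i 1 * x)). pose proof (COS_bound (2 * PI * x)).
  assert (0 <= (1 - cos (2 * PI * x)) / (INR i * INR i)).
  { apply Rmult_le_pos; [lra | left; apply Rinv_0_lt_compat; nra]. }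
  apply Rmult_le_reg_l with (1 - cos (freq i 1 * x)); lra.
Qed.

Lemma cos_2PI_nat (n : nat) : cos (2 * PI * INR n) = 1.
Proof.
replace (2 * PI * INR n) with (0 + 2 * INR n * PI) by ring.
now rewrite cos_period, cos_0.
Qed.

Lemma phiR_eq_0 (i n : nat) : (2 <= i)%nat ->
  cos (freq i 1 * INR n) <> 1 -> phiR i (INR n) = 0.
Proof.
intros Hi Hc; pose proof (phiR_closed_form i (INR n) Hi) as H.
rewrite cos_2PI_nat in H. unfold Rdiv in H; rewrite Rminus_diag, Rmult_0_l in H.
destruct (Rmult_integral _ _ H); [lra | easy].
Qed.

Lemma phiR_zero_min (i : nat) (x : R) : (2 <= i)%nat -> phiR i x = 0 ->
  phiR' i x = 0 /\ 0 <= phiR'' i x.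
Proof.
intros Hi H0.
destruct (cubic_perturbation_nonneg (- phiR' i x) (phiR'' i x / 2) taylor_const)
  as [H1 H2]; [| lra].
intros h.
pose proof (phiR_taylor i x h Hi) as HT; apply Rabs_le_between in HT.
pose proof (phiR_nonneg i (x - h) Hi). lra.
Qed.

(** An integer is a zero, hence a minimum, of phi_i, unless i divides it; then
    every sine in phi_i' vanishes. *)
Lemma phiR'_eq_0 (i n : nat) : (2 <= i)%nat -> phiR' i (INR n) = 0.
Proof.
intros Hi; destruct (Req_dec (cos (freq i 1 * INR n)) 1) as [Hc|Hc].
- unfold phiR'. rewrite (fejer_sum_ext i _ (fun _ => 0 * 0 + 0 * 0)).
  + rewrite (fejer_sum_lin i 0 0 (fun _ => 0) (fun _ => 0)); ring.
  + intros k _; rewrite (freq_mul i k (INR n)), (proj2 (cos_sin_multiple _ k Hc)); ring.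
- apply (phiR_zero_min i (INR n) Hi), phiR_eq_0; easy.
Qed.

Lemma cos_freq_divides (i n : nat) : (2 <= i)%nat ->
  cos (freq i 1 * INR n) = 1 <-> (Z.of_nat i | Z.of_nat n)%Z.
Proof.
intros Hi; pose proof (INR_ge2_pos i Hi). pose proof PI_RGT_0. split.
- intros Hc.
  set (u := PI * INR n / INR i).
  assert (Hu : freq i 1 * INR n = 2 * u) by (unfold freq, u; simpl; field; lra).
  rewrite Hu, cos_2a_sin in Hc.
  assert (Hs : sin u = 0) by nra.
  destruct (sin_eq_0_0 u Hs) as [m Hm].
  exists m. apply eq_IZR. rewrite mult_IZR, <- 2!INR_IZR_INZ.
  apply Rmult_eq_reg_l with (PI / INR i);
    [| apply Rgt_not_eq; apply Rdiv_lt_0_compat; lra].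
  transitivity u; [unfold u; field; lra | rewrite Hm; field; lra].
- intros [m Hm].
  assert (exists k, n = (k * i)%nat) as [k ->].
  { exists (Z.to_nat m). nia. }
  replace (freq i 1 * INR (k * i)) with (2 * PI * INR k); [apply cos_2PI_nat|].
  unfold freq; rewrite mult_INR; simpl; field; lra.
Qed.

Lemma prime_freq (p i : nat) : prime (Z.of_nat p) -> (2 <= i)%nat -> i <> p ->
  cos (freq i 1 * INR p) <> 1.
Proof.
intros Hp Hi Hip Hc; apply cos_freq_divides in Hc; [| easy].
destruct (prime_divisors _ Hp _ Hc) as [H|[H|[H|H]]]; lia.
Qed.

Lemma prime_ge5_not_divides (p i : nat) : prime_ge5 p -> (2 <= i <= 4)%nat ->
  ~ (Z.of_nat i | Z.of_nat p)%Z.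
Proof.
intros [Hp Hp5] Hi Hd. destruct (prime_divisors _ Hp _ Hd) as [H|[H|[H|H]]]; lia.
Qed.

(** * Second derivatives at a prime *)

Lemma cos_mode_root (i n : nat) : (2 <= i)%nat ->
  cos (INR i * (freq i 1 * INR n)) = 1.
Proof. intros Hi; rewrite freq_full by easy; apply cos_2PI_nat. Qed.

(** c = cos (PI n) satisfies 2 c^2 - 1 = 1, and c <> 1 since n is odd. *)
Lemma cos_half_mode (n : nat) : ~ (2 | Z.of_nat n)%Z -> cos (PI * INR n) = -1.
Proof.
intros Hn. pose proof (cos_mode_root 2 n (le_n _)) as H.
assert (Hc : cos (freq 2 1 * INR n) <> 1) by (now rewrite cos_freq_divides).
replace (freq 2 1 * INR n) with (PI * INR n) in * by (unfold freq; simpl; field).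
simpl (INR 2) in H. replace (1 + 1) with 2 in H by ring.
rewrite cos_2a_cos in H. nra.
Qed.

(** c = cos (2 PI n / 3) satisfies 4 c^3 - 3 c = 1, that is
    (c - 1) (2 c + 1)^2 = 0. *)
Lemma cos_third_mode (n : nat) : ~ (3 | Z.of_nat n)%Z ->
  cos (freq 3 1 * INR n) = - / 2.
Proof.
intros Hn. pose proof (cos_mode_root 3 n ltac:(lia)) as H.
assert (Hc : cos (freq 3 1 * INR n) <> 1) by (rewrite cos_freq_divides; [easy | lia]).
set (t := freq 3 1 * INR n) in *.
replace (INR 3 * t) with (2 * t + t) in H by (simpl; ring).
rewrite cos_plus, cos_2a_cos, sin_2a in H.
pose proof (sin2_cos2 t) as Hs; unfold Rsqr in Hs.
assert (H3 : (cos t - 1) * ((2 * cos t + 1) * (2 * cos t + 1)) = 0) by nra.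
destruct (Rmult_integral _ _ H3) as [H4|H4]; [lra|].
destruct (Rmult_integral _ _ H4); lra.
Qed.

Lemma phiR''_2 (n : nat) : ~ (2 | Z.of_nat n)%Z -> phiR'' 2 (INR n) = PI ^ 2 / 2.
Proof.
intros Hn; unfold phiR'', fejer_sum; simpl (2 - 1)%nat.
rewrite sum_R_last, sum_R_empty.
replace (freq 2 1) with PI by (unfold freq; simpl; field).
rewrite cos_half_mode by easy. simpl; field.
Qed.

Lemma phiR''_3 (n : nat) : ~ (3 | Z.of_nat n)%Z -> phiR'' 3 (INR n) = 8 * PI ^ 2 / 27.
Proof.
intros Hn; unfold phiR'', fejer_sum; simpl (3 - 1)%nat.
rewrite 2!sum_R_last, sum_R_empty.
pose proof (cos_third_mode n Hn) as Hc.
rewrite (freq_mul 3 2). simpl (INR 2). replace (1 + 1) with 2 by ring.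
rewrite cos_2a_cos, Hc. unfold freq; simpl; field.
Qed.

(** For odd n, phi_2(n - h) = sin^2 (PI h / 2), which dominates a multiple of h^2
    on the whole of [0, 1]; this controls zeros that are not known to be close to n. *)
Lemma phiR_2_lower (n : nat) (h : R) : ~ (2 | Z.of_nat n)%Z -> 0 <= h <= 1 ->
  h ^ 2 / 4 <= phiR 2 (INR n - h).
Proof.
intros Hn Hh; unfold phiR, fejer_sum; simpl (2 - 1)%nat.
rewrite sum_R_last, sum_R_empty.
replace (freq 2 1 * (INR n - h)) with (PI * INR n - 2 * (PI * h / 2))
  by (unfold freq; simpl; field).
rewrite cos_minus, cos_half_mode by easy.
assert (Hs : sin (PI * INR n) = 0).
{ pose proof (sin2_cos2 (PI * INR n)) as H; unfold Rsqr in H.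
  rewrite cos_half_mode in H by easy. nra. }
rewrite Hs, cos_2a_sin.
set (t := PI * h / 2).
assert (Ht : 3 / 2 * h <= t <= 2).
{ unfold t; pose proof PI2_3_2; pose proof PI_4; split; nra. }
pose proof (sin_lower_cubic t ltac:(lra)) as Hsin.
assert (h / 2 <= sin t) by nra.
simpl; nra.
Qed.

Lemma weighted_squares_sum (N : R) (m : nat) :
  sum_n_m (fun k => (N - INR k) * INR k ^ 2) 1 m
  = N * (INR m * (INR m + 1) * (2 * INR m + 1) / 6) - (INR m * (INR m + 1) / 2) ^ 2 :> R.
Proof.
induction m as [|m IH].
- rewrite sum_R_empty. simpl; field.
- rewrite sum_R_last, IH, S_INR. real_eq. field.
Qed.

(** If i divides n, all cosines equal 1 and
    phi_i''(n) = - (2 PI^2 / 3) (1 - 1 / i^2). *)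
Lemma phiR''_divides_lower (i n : nat) : (2 <= i)%nat ->
  cos (freq i 1 * INR n) = 1 -> - (2 * PI ^ 2 / 3) <= phiR'' i (INR n).
Proof.
intros Hi Hc; pose proof (INR_ge2_pos i Hi) as Hi0; unfold phiR'', fejer_sum.
assert (Hs : sum_n_m (fun k => INR (i - k) * (freq i k ^ 2 * cos (freq i k * INR n))) 1 (i - 1)
  = (4 * PI ^ 2 / INR i ^ 2) * (INR i ^ 2 * (INR i ^ 2 - 1) / 12)).
{ rewrite (sum_R_ext _ (fun k => (4 * PI ^ 2 / INR i ^ 2) * ((INR i - INR k) * INR k ^ 2))).
  - rewrite sum_R_scal, weighted_squares_sum, minus_INR by lia. simpl (INR 1).
    f_equal. field.
  - intros k Hk. rewrite freq_mul, (proj1 (cos_sin_multiple _ k Hc)), minus_INR by lia.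
    unfold freq. field. lra. }
rewrite Hs. pose proof (pow2_ge_0 PI).
replace (2 * (4 * PI ^ 2 / INR i ^ 2 * (INR i ^ 2 * (INR i ^ 2 - 1) / 12)) / (INR i * INR i))
  with (2 * PI ^ 2 / 3 * (1 - (/ INR i) ^ 2)) by (field; lra).
pose proof (pow2_ge_0 (/ INR i)). nra.
Qed.

(** * Sums with geometric weights *)

(** The weights q^(-i) are summable, so on bounded f this operator is linear,
    monotone and bounded.  The shift keeps the argument of f equal to the exponent of q. *)
Definition qsum (q : R) (f : nat -> R) : R :=
  Series (fun n => / q ^ (n + 2) * f (n + 2)%nat).

Lemma qpow_inv_pos (q : R) (hq : 1 < q) (n : nat) : 0 < / q ^ n.
Proof. apply Rinv_0_lt_compat, pow_lt; lra. Qed.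

Lemma ex_qsum (q : R) (hq : 1 < q) (B : R) (f : nat -> R) :
  (forall i, (2 <= i)%nat -> Rabs (f i) <= B) ->
  ex_series (fun n => / q ^ (n + 2) * f (n + 2)%nat).
Proof.
intros Hf.
apply (ex_series_le (K := R_AbsRing) (V := R_CompleteNormedModule) _
  (fun n => B * (/ q) ^ n)).
- intros n; change (norm (/ q ^ (n + 2) * f (n + 2)%nat))
    with (Rabs (/ q ^ (n + 2) * f (n + 2)%nat)).
  pose proof (qpow_inv_pos q hq (n + 2)).
  rewrite Rabs_mult, Rabs_pos_eq, Rmult_comm by lra.
  apply Rmult_le_compat; [apply Rabs_pos | lra | apply Hf; lia |].
  rewrite pow_inv; apply Rinv_le_contravar; [apply pow_lt; lra|].
  apply Rle_pow; [lra | lia].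
- apply (ex_series_scal_l (K := R_AbsRing) (V := R_NormedModule) B).
  apply ex_series_geom. rewrite Rabs_pos_eq.
  + rewrite <- Rinv_1; apply Rinv_lt_contravar; lra.
  + left; apply Rinv_0_lt_compat; lra.
Qed.

Lemma qsum_ext (q : R) (f g : nat -> R) :
  (forall i, (2 <= i)%nat -> f i = g i) -> qsum q f = qsum q g.
Proof. intros H; apply Series_ext; intros n; now rewrite H by lia. Qed.

Lemma qsum_lin (q : R) (hq : 1 < q) (B a b : R) (f g : nat -> R) :
  (forall i, (2 <= i)%nat -> Rabs (f i) <= B) ->
  (forall i, (2 <= i)%nat -> Rabs (g i) <= B) ->
  qsum q (fun i => a * f i + b * g i) = a * qsum q f + b * qsum q g.
Proof.
intros Hf Hg; unfold qsum.
rewrite <- 2!Series_scal_l, <- Series_plus.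
- apply Series_ext; intros n; ring.
- apply (ex_series_scal_l (K := R_AbsRing) (V := R_NormedModule) a), (ex_qsum q hq B f Hf).
- apply (ex_series_scal_l (K := R_AbsRing) (V := R_NormedModule) b), (ex_qsum q hq B g Hg).
Qed.

Lemma qsum_0 (q : R) : qsum q (fun _ => 0) = 0.
Proof.
unfold qsum; rewrite (Series_ext _ (fun n => 0 * 0)) by (intros; ring).
rewrite Series_scal_l; ring.
Qed.

Lemma qsum_nonneg (q : R) (hq : 1 < q) (B : R) (f : nat -> R) :
  (forall i, (2 <= i)%nat -> 0 <= f i <= B) -> 0 <= qsum q f.
Proof.
intros Hf; rewrite <- (qsum_0 q). apply Series_le.
- intros n; pose proof (qpow_inv_pos q hq (n + 2)). specialize (Hf (n + 2)%nat ltac:(lia)). nra.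
- apply (ex_qsum q hq B); intros i Hi. specialize (Hf i Hi). rewrite Rabs_pos_eq; lra.
Qed.

Lemma qsum_le (q : R) (hq : 1 < q) (B : R) (f g : nat -> R) :
  (forall i, (2 <= i)%nat -> Rabs (f i) <= B) ->
  (forall i, (2 <= i)%nat -> Rabs (g i) <= B) ->
  (forall i, (2 <= i)%nat -> f i <= g i) -> qsum q f <= qsum q g.
Proof.
intros Hf Hg Hfg.
assert (0 <= qsum q (fun i => 1 * g i + -1 * f i)).
{ apply (qsum_nonneg q hq (2 * B)); intros i Hi.
  specialize (Hfg i Hi); specialize (Hf i Hi); specialize (Hg i Hi).
  apply Rabs_le_between in Hf, Hg. lra. }
rewrite (qsum_lin q hq B) in H by easy. lra.
Qed.

Lemma qsum_abs_le (q : R) (hq : 1 < q) (B : R) (f : nat -> R) :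
  (forall i, (2 <= i)%nat -> Rabs (f i) <= B) ->
  Rabs (qsum q f) <= B * qsum q (fun _ => 1).
Proof.
intros Hf.
assert (H1 : qsum q (fun i => B * 1 + 0 * 0) = B * qsum q (fun _ => 1)).
{ rewrite (qsum_lin q hq 1) with (g := fun _ => 0); [ring | |];
    intros; rewrite ?Rabs_R1, ?Rabs_R0; lra. }
assert (H2 : qsum q (fun i => - B * 1 + 0 * 0) = - B * qsum q (fun _ => 1)).
{ rewrite (qsum_lin q hq 1) with (g := fun _ => 0); [ring | |];
    intros; rewrite ?Rabs_R1, ?Rabs_R0; lra. }
assert (HB : 0 <= B) by (eapply Rle_trans; [apply Rabs_pos | apply (Hf 2%nat); lia]).
apply Rabs_le; split.
- replace (- (B * qsum q (fun _ => 1))) with (- B * qsum q (fun _ => 1)) by ring.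
  rewrite <- H2. apply (qsum_le q hq B); [| easy |].
  + intros; apply Rabs_le; lra.
  + intros i Hi; specialize (Hf i Hi); apply Rabs_le_between in Hf; lra.
- rewrite <- H1. apply (qsum_le q hq B); [easy | |].
  + intros; apply Rabs_le; lra.
  + intros i Hi; specialize (Hf i Hi); apply Rabs_le_between in Hf; lra.
Qed.

Definition spike (m : nat) (i : nat) : R := if Nat.eqb i m then 1 else 0.

Lemma spike_bound (m i : nat) : Rabs (spike m i) <= 1.
Proof. unfold spike; destruct (Nat.eqb i m); rewrite ?Rabs_R1, ?Rabs_R0; lra. Qed.

Lemma qsum_spike (q : R) (hq : 1 < q) (m : nat) : (2 <= m)%nat -> qsum q (spike m) = / q ^ m.
Proof.
intros Hm; unfold qsum.
rewrite (Series_incr_n_aux _ (m - 2)).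
- rewrite Series_incr_1.
  + replace (m - 2 + 0 + 2)%nat with m by lia. unfold spike at 1; rewrite Nat.eqb_refl.
    rewrite (Series_ext _ (fun n => 0 * 0)).
    * rewrite Series_scal_l; ring.
    * intros n; unfold spike. destruct (Nat.eqb_spec (m - 2 + S n + 2) m); [lia | ring].
  + apply (ex_series_incr_n (K := R_AbsRing) (V := R_NormedModule)
      (fun n => / q ^ (n + 2) * spike m (n + 2)) (m - 2)).
    apply (ex_qsum q hq 1); intros; apply spike_bound.
- intros k Hk; unfold spike. destruct (Nat.eqb_spec (k + 2) m); [lia | ring].
Qed.

(** Terms are split off one at a time by subtracting a multiple of [spike]; what
    remains has nonnegative terms. *)
Lemma qsum_ge_partial (q B : R) (l : list nat) (f : nat -> R) : 1 < q ->
  List.NoDup l -> (forall m, List.In m l -> (2 <= m)%nat) ->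
  (forall i, (2 <= i)%nat -> Rabs (f i) <= B) ->
  (forall i, (2 <= i)%nat -> ~ List.In i l -> 0 <= f i) ->
  List.fold_right (fun m s => / q ^ m * f m + s) 0 l <= qsum q f.
Proof.
intros hq Hnd; revert f; induction Hnd as [|m l Hm Hnd IH]; intros f Hl Hf Hpos.
- apply (qsum_nonneg q hq B); intros i Hi; split; [now apply Hpos|].
  eapply Rle_trans; [apply Rle_abs | now apply Hf].
- assert (Hm2 : (2 <= m)%nat) by (apply Hl; now left).
  set (g := fun i => if Nat.eqb i m then 0 else f i).
  assert (HB : 0 <= B) by (eapply Rle_trans; [apply Rabs_pos | now apply (Hf m)]).
  assert (Hg : forall i, (2 <= i)%nat -> Rabs (g i) <= B).
  { intros i Hi; unfold g; destruct (Nat.eqb i m); [now rewrite Rabs_R0 | now apply Hf]. }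
  assert (Hfg : qsum q f = f m * / q ^ m + 1 * qsum q g).
  { rewrite <- (qsum_spike q hq m Hm2), <- (qsum_lin q hq (B + 1)).
    - apply qsum_ext; intros i _; unfold g, spike.
      destruct (Nat.eqb_spec i m) as [->|_]; ring.
    - intros i _; pose proof (spike_bound m i); lra.
    - intros i Hi; specialize (Hg i Hi); lra. }
  rewrite Hfg; simpl.
  replace (List.fold_right (fun m s => / q ^ m * f m + s) 0 l)
    with (List.fold_right (fun m s => / q ^ m * g m + s) 0 l).
  + enough (List.fold_right (fun m s => / q ^ m * g m + s) 0 l <= qsum q g) by lra.
    apply IH; [| exact Hg |].
    * intros k Hk; apply Hl; now right.
    * intros i Hi Hin; unfold g. destruct (Nat.eqb_spec i m) as [_|Him]; [lra|].
      apply Hpos; [easy|]. intros [->|H]; [now apply Him | easy].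
  + clear - Hm. induction l as [|k l IH]; [easy|]. simpl. rewrite IH.
    * unfold g; destruct (Nat.eqb_spec k m) as [->|_]; [| easy].
      exfalso; apply Hm; now left.
    * intros H; apply Hm; now right.
Qed.

Definition total_weight (q : R) : R := qsum q (fun _ => 1).

Lemma total_weight_pos (q : R) : 1 < q -> 0 < total_weight q.
Proof.
intros hq. pose proof (qpow_inv_pos q hq 2).
enough (qsum q (spike 2) <= total_weight q) by (rewrite (qsum_spike q hq) in *; [lra | lia]).
apply (qsum_le q hq 1).
- intros; apply spike_bound.
- intros; rewrite Rabs_R1; lra.
- intros i _; generalize (spike_bound 2 i); rewrite Rabs_le_between; lra.
Qed.

(** * From complex to real functions *)

Lemma is_derive_fejer_sum (i : nat) (f : R -> nat -> R) (df : nat -> R) (x : R) :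
  (forall k, is_derive (fun t => f t k) x (df k)) ->
  is_derive (fun t => fejer_sum i (f t)) x (fejer_sum i df).
Proof.
intros H; unfold fejer_sum.
assert (Hs : forall m, is_derive (fun t => sum_n_m (fun k => INR (i - k) * f t k) 1 m : R) x
  (sum_n_m (fun k => INR (i - k) * df k) 1 m)).
{ induction m as [|m IH].
  - apply (is_derive_ext (fun _ => 0)).
    + intros t; now rewrite sum_R_empty.
    + rewrite sum_R_empty; apply (is_derive_const (K := R_AbsRing) (V := R_NormedModule) 0).
  - apply (is_derive_ext (fun t => sum_n_m (fun k => INR (i - k) * f t k) 1 m
      + INR (i - S m) * f t (S m))).
    + intros t; now rewrite sum_R_last.
    + rewrite sum_R_last.
      apply (is_derive_plus (K := R_AbsRing) (V := R_NormedModule)); [exact IH|].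
      apply is_derive_scal, H. }
apply (is_derive_ext (fun t => (2 / (INR i * INR i)) *
  sum_n_m (fun k => INR (i - k) * f t k) 1 (i - 1))).
- intros t; real_eq; unfold Rdiv; ring.
- replace (2 * sum_n_m (fun k => INR (i - k) * df k) 1 (i - 1) / (INR i * INR i))
    with (2 / (INR i * INR i) * sum_n_m (fun k => INR (i - k) * df k) 1 (i - 1))
    by (unfold Rdiv; ring).
  apply is_derive_scal, Hs.
Qed.

Lemma fejer_sum_opp (i : nat) (f : nat -> R) : fejer_sum i (fun k => - f k) = - fejer_sum i f.
Proof.
rewrite (fejer_sum_ext i _ (fun k => -1 * f k + 0 * f k)) by (intros; ring).
rewrite fejer_sum_lin; ring.
Qed.

Lemma is_derive_phiR (i : nat) (x : R) : is_derive (phiR i) x (phiR' i x).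
Proof.
unfold phiR, phiR'; rewrite <- fejer_sum_opp.
replace (fejer_sum i _) with (0 + fejer_sum i (fun k => - (freq i k * sin (freq i k * x)))) by ring.
apply (is_derive_plus (K := R_AbsRing) (V := R_NormedModule)).
- apply (is_derive_const (K := R_AbsRing) (V := R_NormedModule)).
- apply (is_derive_fejer_sum i (fun t k => cos (freq i k * t))).
  intros k; auto_derive; [easy | ring].
Qed.

Lemma is_derive_phiR' (i : nat) (x : R) : is_derive (phiR' i) x (phiR'' i x).
Proof.
unfold phiR', phiR''. apply (is_derive_opp (K := R_AbsRing) (V := R_NormedModule)).
apply (is_derive_fejer_sum i (fun t k => freq i k * sin (freq i k * t))).
intros k; auto_derive; [easy | ring].
Qed.

(** The limit that defines [C_derive] is taken along the horizontal line through
    the point, so on the real axis it sees only real difference quotients. *)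
Lemma C_derive_real (f : C -> C) (g : R -> R) (x l : R) :
  (forall t, f (RtoC t) = RtoC (g t)) -> is_derive g x l ->
  C_derive f (RtoC x) = RtoC l.
Proof.
intros Hfg Hd; apply is_derive_Reals in Hd.
assert (Hq : forall y, y <> x ->
  ((f (RtoC y) - f (RtoC x)) / (RtoC y - RtoC x))%C = RtoC ((g y - g x) / (y - x))).
{ intros y Hy. rewrite 2!Hfg, <- 2!RtoC_minus, <- RtoC_div; [easy | lra]. }
set (r := fun y => ((f (RtoC y) - f (RtoC x)) / (RtoC y - RtoC x))%C) in *.
apply injective_projections;
  [change (real (Lim (fun y => fst (r y)) x) = real l)
  | change (real (Lim (fun y => snd (r y)) x) = real 0)];
  apply f_equal, is_lim_unique, is_lim_spec; intros eps;
  destruct (Hd eps (cond_pos eps)) as [d Hdelta]; exists d; intros y Hy Hyx;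
  unfold r; rewrite Hq by easy; simpl.
- specialize (Hdelta (y - x) ltac:(lra) Hy).
  now rewrite Rplus_minus in Hdelta.
- rewrite Rminus_0_r, Rabs_R0; apply cond_pos.
Qed.

Lemma Ccos_real (x : R) : Ccos (RtoC x) = RtoC (cos x).
Proof.
unfold Ccos, Cexp, Ci; apply injective_projections; simpl;
  rewrite ?Rmult_0_l, ?Rmult_0_r, ?Rmult_1_l, ?Rminus_0_r, ?Rplus_0_r, ?Rplus_0_l, ?Ropp_0,
    ?exp_0, ?cos_neg, ?sin_neg; field.
Qed.

Lemma phi_real (i : nat) (x : R) : (2 <= i)%nat -> phi i (RtoC x) = RtoC (phiR i x).
Proof.
intros Hi; pose proof (INR_ge2_pos i Hi) as Hi0.
assert (Hs : forall m, sum_n_m (fun k =>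
    (INR (i - k) * Ccos (2 * PI * INR k * x / INR i))%C) 1 m
  = RtoC (sum_n_m (fun k => INR (i - k) * cos (freq i k * x)) 1 m)).
{ induction m as [|m IH].
  - rewrite sum_R_empty, sum_n_m_zero by lia; reflexivity.
  - rewrite sum_R_last, RtoC_plus, sum_n_Sm, IH by lia.
    change (@plus C_AbelianMonoid) with Cplus. f_equal.
    rewrite RtoC_mult, <- Ccos_real. f_equal. f_equal.
    unfold freq. rewrite <- !RtoC_mult, <- RtoC_div by lra. f_equal; field; lra. }
unfold phi, Fejer. rewrite Hs. unfold phiR, fejer_sum.
rewrite <- !RtoC_mult, <- RtoC_plus, <- RtoC_div by nra. f_equal; field; lra.
Qed.

Lemma phi''_real (i : nat) (x : R) : (2 <= i)%nat -> phi'' i (RtoC x) = RtoC (phiR'' i x).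
Proof.
intros Hi; unfold phi''.
apply (C_derive_real _ (phiR' i)); [| apply is_derive_phiR'].
intros t; apply (C_derive_real _ (phiR i)); [| apply is_derive_phiR].
intros s; now apply phi_real.
Qed.

Lemma CSeries_real (u : nat -> C) (v : nat -> R) :
  (forall n, u n = RtoC (v n)) -> CSeries u = RtoC (Series v).
Proof.
intros H; unfold CSeries, RtoC; f_equal.
- apply Series_ext; intros n; now rewrite H.
- rewrite (Series_ext _ (fun n => 0 * 0)).
  + rewrite Series_scal_l; ring.
  + intros n; rewrite H; simpl; ring.
Qed.

Definition gap (q x : R) : R := qsum q (fun i => phiR i x) - exp (- x * ln q).

Lemma frakF_real (q x : R) : frakF (RtoC x) q = RtoC ((q - 1) * q * gap q x).
Proof.
unfold frakF, gap, qsum.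
rewrite (CSeries_real _ (fun n => / q ^ (n + 2) * phiR (n + 2) x)).
- replace (Cpow_opp q x) with (RtoC (exp (- x * ln q))).
  + now rewrite <- !RtoC_minus, <- !RtoC_mult.
  + unfold Cpow_opp, Cexp. rewrite <- RtoC_opp, <- RtoC_mult, re_RtoC, im_RtoC, cos_0, sin_0.
    unfold RtoC; f_equal; ring.
- intros n; rewrite phi_real by lia; now rewrite RtoC_mult.
Qed.

Definition K_re (q : R) (p : nat) : R :=
  / 2 * (qsum q (fun i => phiR'' i (INR p)) - / q ^ p * ln q ^ 2).

Lemma K_real (q : R) (p : nat) : K q p = RtoC (K_re q p).
Proof.
unfold K, K_re, qsum.
rewrite (CSeries_real _ (fun n => / q ^ (n + 2) * phiR'' (n + 2) (INR p))).
- rewrite <- RtoC_minus, <- RtoC_inv, <- RtoC_mult by lra; easy.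
- intros n; rewrite phi''_real by lia; now rewrite RtoC_mult.
Qed.

Lemma left_zero_iff (q : R) (p : nat) (x : R) : 1 < q ->
  left_zero q p x <-> INR p - 1 < x < INR p /\ gap q x = 0.
Proof.
intros hq; unfold left_zero; rewrite frakF_real; split; intros [Hx H]; split; try easy.
- apply RtoC_inj in H. destruct (Rmult_integral _ _ H) as [H'|]; [nra | easy].
- now rewrite H, Rmult_0_r.
Qed.

(** * Expansion at a prime *)

Lemma ln_pos (q : R) : 1 < q -> 0 < ln q.
Proof. intros hq; rewrite <- ln_1; apply ln_increasing; lra. Qed.

Lemma phiR_at_prime (p i : nat) : prime (Z.of_nat p) -> (2 <= i)%nat ->
  phiR i (INR p) = spike p i.
Proof.
intros Hp Hi; unfold spike; destruct (Nat.eqb_spec i p) as [->|Hip].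
- apply phiR_eq_1; [easy|]. apply cos_freq_divides; [easy | exists 1%Z; lia].
- apply phiR_eq_0; [easy|]. now apply prime_freq.
Qed.

Lemma exp_decay (q : R) (p : nat) (h : R) : 1 < q ->
  exp (- (INR p - h) * ln q) = / q ^ p * exp (h * ln q).
Proof.
intros hq. replace (- (INR p - h) * ln q) with (- (INR p * ln q) + h * ln q) by ring.
rewrite exp_plus, exp_Ropp. fold (Rpower q (INR p)). rewrite Rpower_pow; [easy | lra].
Qed.

(** The Taylor expansion at y bounds |phi_i(x) - phi_i(y)| by a multiple of |x - y|
    that does not depend on i. *)
Lemma qsum_phiR_continuous (q : R) : 1 < q -> continuity (fun x => qsum q (fun i => phiR i x)).
Proof.
intros hq y. pose proof (total_weight_pos q hq) as HZ. pose proof taylor_const_bounds as HA.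
set (c := 3 * taylor_const * total_weight q). assert (Hc : 0 < c) by (unfold c; nra).
intros eps Heps. exists (Rmin 1 (eps / (2 * c))). split.
{ apply Rmin_pos; [lra|]. apply Rdiv_lt_0_compat; lra. }
intros x [_ Hx]. simpl in *; unfold Rdist in *.
assert (Hx1 : Rabs (x - y) < 1) by (eapply Rlt_le_trans; [exact Hx | apply Rmin_l]).
assert (Hx2 : Rabs (x - y) < eps / (2 * c)) by (eapply Rlt_le_trans; [exact Hx | apply Rmin_r]).
assert (H : Rabs (qsum q (fun i => 1 * phiR i x + -1 * phiR i y))
  <= 3 * taylor_const * Rabs (x - y) * total_weight q).
{ apply (qsum_abs_le q hq); intros i Hi.
  pose proof (phiR_taylor i y (y - x) Hi) as HT.
  replace (y - (y - x)) with x in HT by ring.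
  rewrite (Rabs_minus_sym y x) in HT.
  pose proof (phiR'_bound i y Hi) as H1. pose proof (phiR''_bound i y Hi) as H2.
  set (d := Rabs (x - y)) in *. pose proof (Rabs_pos (x - y)) as Hd; fold d in Hd.
  replace (1 * phiR i x + -1 * phiR i y)
    with ((phiR i x - phiR i y + (y - x) * phiR' i y - (y - x) ^ 2 / 2 * phiR'' i y)
      + (- (y - x) * phiR' i y + (y - x) ^ 2 / 2 * phiR'' i y)) by ring.
  eapply Rle_trans; [apply Rabs_triang|].
  assert (H3 : Rabs (- (y - x) * phiR' i y + (y - x) ^ 2 / 2 * phiR'' i y)
    <= d * taylor_const + d ^ 2 / 2 * taylor_const).
  { eapply Rle_trans; [apply Rabs_triang|]. rewrite 2!Rabs_mult, Rabs_Ropp.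
    rewrite (Rabs_minus_sym y x); fold d.
    replace (Rabs ((y - x) ^ 2 / 2)) with (d ^ 2 / 2).
    - pose proof (pow2_ge_0 d). apply Rplus_le_compat; apply Rmult_le_compat_l; lra.
    - rewrite (Rabs_pos_eq (_ / 2)) by (pose proof (pow2_ge_0 (y - x)); lra).
      unfold d; rewrite pow2_abs; f_equal; ring. }
  assert (d ^ 3 <= d) by nra. assert (d ^ 2 <= d) by nra. nra. }
rewrite (qsum_lin q hq taylor_const) in H by (intros; now apply phiR_bound).
replace (1 * _ + -1 * _) with (qsum q (fun i => phiR i x) - qsum q (fun i => phiR i y))
  in H by ring.
eapply Rle_lt_trans; [exact H|].
replace (3 * taylor_const * Rabs (x - y) * total_weight q) with (Rabs (x - y) * c)
  by (unfold c; ring).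
apply Rle_lt_trans with (eps / (2 * c) * c).
- apply Rmult_le_compat_r; lra.
- replace (eps / (2 * c) * c) with (eps / 2) by (field; lra). lra.
Qed.

Lemma gap_continuous (q : R) : 1 < q -> continuity (gap q).
Proof.
intros hq y. apply (continuity_pt_minus (fun x => qsum q (fun i => phiR i x))).
- now apply qsum_phiR_continuous.
- apply continuity_pt_filterlim, (ex_derive_continuous (fun x => exp (- x * ln q))).
  now auto_derive.
Qed.

(** Summation over i of the Taylor expansions of phi_i at p: the constant terms
    add up to q^(-p), which cancels with q^(-x) at x = p, and the linear terms vanish. *)
Lemma gap_expansion (q : R) (p : nat) (h : R) : 1 < q -> prime (Z.of_nat p) -> (2 <= p)%nat ->
  Rabs (gap q (INR p - h) - (h ^ 2 / 2 * qsum q (fun i => phiR'' i (INR p))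
    - / q ^ p * (exp (h * ln q) - 1))) <= taylor_const * total_weight q * Rabs h ^ 3.
Proof.
intros hq Hp Hp2.
assert (H : Rabs (qsum q (fun i => 1 * (1 * phiR i (INR p - h) + -1 * phiR i (INR p))
  + (- (h ^ 2 / 2)) * phiR'' i (INR p))) <= taylor_const * Rabs h ^ 3 * total_weight q).
{ apply (qsum_abs_le q hq); intros i Hi.
  pose proof (phiR_taylor i (INR p) h Hi) as HT; rewrite phiR'_eq_0 in HT by easy.
  eapply Rle_trans; [| exact HT]. right; f_equal; ring. }
assert (HA := taylor_const_bounds).
rewrite (qsum_lin q hq (2 * taylor_const)), (qsum_lin q hq taylor_const) in H.
2, 3: intros; now apply phiR_bound.
2: { intros i Hi. pose proof (phiR_bound i (INR p - h) Hi) as H1.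
     pose proof (phiR_bound i (INR p) Hi) as H2. apply Rabs_le_between in H1, H2.
     apply Rabs_le; lra. }
2: { intros i Hi; pose proof (phiR''_bound i (INR p) Hi); lra. }
assert (HE : qsum q (fun i => phiR i (INR p)) = / q ^ p).
{ rewrite (qsum_ext q _ (spike p)); [now apply qsum_spike|].
  intros; now apply phiR_at_prime. }
rewrite HE in H. unfold gap; rewrite exp_decay by easy.
eapply Rle_trans; [| eapply Rle_trans; [exact H | right; ring]].
right; f_equal; ring.
Qed.

(** * Positivity of the quadratic coefficient *)

(** Stated with u = 1/q and L = log q.  After division by u^2 and the use of
    PI^2 >= 9, what remains is a cubic polynomial that is positive on (0, 1]. *)
Lemma K_positivity_inequality (u L : R) : 0 < u < 1 -> 0 <= L -> L * u <= 1 - u ->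
  0 < u ^ 2 * (PI ^ 2 / 2) + u ^ 3 * (8 * PI ^ 2 / 27)
      - u ^ 5 * (2 * PI ^ 2 / 3 + L ^ 2).
Proof.
intros Hu HL HLu.
assert (Hpi : 9 <= PI ^ 2) by (pose proof PI2_3_2; nra).
assert (HL2 : (L * u) ^ 2 <= (1 - u) ^ 2) by (apply pow_incr; split; nra).
assert (Hc : 0 <= 1 / 2 + 8 * u / 27 - 2 * u ^ 3 / 3) by nra.
replace (u ^ 2 * (PI ^ 2 / 2) + u ^ 3 * (8 * PI ^ 2 / 27) - u ^ 5 * (2 * PI ^ 2 / 3 + L ^ 2))
  with (u ^ 2 * (PI ^ 2 * (1 / 2 + 8 * u / 27 - 2 * u ^ 3 / 3) - u * (L * u) ^ 2)) by field.
apply Rmult_lt_0_compat; [apply pow_lt; lra|].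
(* 1/2 + 8u/27 - 2u^3/3 is nonnegative, so PI^2 may be replaced by 9. *)
apply Rlt_le_trans with (9 * (1 / 2 + 8 * u / 27 - 2 * u ^ 3 / 3) - u * (1 - u) ^ 2); nra.
Qed.

(** Terms with i other than p are nonnegative because p is a zero and hence a
    minimum of phi_i.  Among them i = 2 alone does not outweigh the term i = p when q is
    close to 1 and p = 5, but i = 2 and i = 3 together do. *)
Lemma K_re_pos (q : R) (p : nat) : 1 < q -> prime_ge5 p -> 0 < K_re q p.
Proof.
intros hq Hp5; pose proof Hp5 as [Hp Hp2].
pose proof (qsum_ge_partial q taylor_const (2%nat :: 3%nat :: p :: nil)%list
  (fun i => phiR'' i (INR p)) hq) as H.
simpl List.fold_right in H. cbv beta in H.
rewrite phiR''_2 in H by now apply (prime_ge5_not_divides p 2 Hp5); lia.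
rewrite phiR''_3 in H by now apply (prime_ge5_not_divides p 3 Hp5); lia.
assert (Hlow : - (2 * PI ^ 2 / 3) <= phiR'' p (INR p)).
{ apply phiR''_divides_lower; [lia|]. apply cos_freq_divides; [lia | exists 1%Z; lia]. }
set (u := / q).
assert (Hu : 0 < u < 1).
{ split; [apply Rinv_0_lt_compat; lra|]. rewrite <- Rinv_1; apply Rinv_lt_contravar; lra. }
assert (HE : / q ^ p <= u ^ 5).
{ unfold u; rewrite pow_inv; apply Rinv_le_contravar; [apply pow_lt; lra|].
  apply Rle_pow; [lra | lia]. }
pose proof (qpow_inv_pos q hq p) as HE0.
assert (HLu : ln q * u <= 1 - u).
{ replace (1 - u) with ((q - 1) * u) by (unfold u; field; lra).
  apply Rmult_le_compat_r; [lra|].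
  pose proof (exp_ineq1_le (ln q)) as He; rewrite exp_ln in He; lra. }
pose proof (K_positivity_inequality u (ln q) Hu (Rlt_le _ _ (ln_pos q hq)) HLu) as HK.
unfold K_re. set (S := qsum _ _) in *.
enough (HS : u ^ 2 * (PI ^ 2 / 2) + (u ^ 3 * (8 * PI ^ 2 / 27)
  + (/ q ^ p * phiR'' p (INR p) + 0)) <= S).
{ assert (0 <= 2 * PI ^ 2 / 3 + ln q ^ 2).
  { pose proof (pow2_ge_0 PI); pose proof (pow2_ge_0 (ln q)); lra. }
  assert (/ q ^ p * (2 * PI ^ 2 / 3 + ln q ^ 2) <= u ^ 5 * (2 * PI ^ 2 / 3 + ln q ^ 2))
    by now apply Rmult_le_compat_r.
  assert (/ q ^ p * (- (2 * PI ^ 2 / 3)) <= / q ^ p * phiR'' p (INR p))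
    by (apply Rmult_le_compat_l; lra).
  lra. }
unfold u; rewrite 2!pow_inv; apply H.
- repeat constructor; simpl; intuition lia.
- simpl; intuition lia.
- intros; now apply phiR''_bound.
- intros i Hi Hin. apply phiR_zero_min; [easy|]. apply phiR_eq_0; [easy|].
  apply prime_freq; [easy | easy |]. intros ->; apply Hin; simpl; tauto.
Qed.

(** * Location of the zeros *)

(** Used twice: to produce a point left of p where [gap] is negative, and to keep
    the zeros away from p. *)
Lemma gap_upper (q : R) (p : nat) (h : R) : 1 < q -> prime_ge5 p -> 0 < h < 1 ->
  gap q (INR p - h) <= 2 * taylor_const * total_weight q * h ^ 2 - / q ^ p * ln q * h.
Proof.
intros hq [Hp Hp5] Hh.
pose proof (gap_expansion q p h hq Hp ltac:(lia)) as HG.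
rewrite (Rabs_pos_eq h) in HG by lra. apply Rabs_le_between in HG.
assert (HS : Rabs (qsum q (fun i => phiR'' i (INR p))) <= taylor_const * total_weight q).
{ apply qsum_abs_le; [easy|]. intros; now apply phiR''_bound. }
apply Rabs_le_between in HS.
pose proof (exp_ineq1_le (h * ln q)). pose proof (qpow_inv_pos q hq p).
pose proof taylor_const_bounds. pose proof (total_weight_pos q hq).
assert (0 < taylor_const * total_weight q) by nra.
assert (h ^ 3 <= h ^ 2) by nra. assert (0 < h ^ 2) by nra.
assert (/ q ^ p * (h * ln q) <= / q ^ p * (exp (h * ln q) - 1))
  by (apply Rmult_le_compat_l; lra).
assert (h ^ 2 / 2 * qsum q (fun i => phiR'' i (INR p))
  <= h ^ 2 / 2 * (taylor_const * total_weight q))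
  by (apply Rmult_le_compat_l; lra).
assert (taylor_const * total_weight q * h ^ 3 <= taylor_const * total_weight q * h ^ 2)
  by (apply Rmult_le_compat_l; lra).
nra.
Qed.

(** At a zero, q^(-2) phi_2 + q^(-p) phi_p is at most q^(-(p - h)).  The first
    term is at least a multiple of h^2, while the other two differ by O(q^(-p) h); one
    factor h cancels. *)
Lemma zero_upper (q : R) (p : nat) (h : R) : 1 < q -> prime_ge5 p -> 0 < h < 1 ->
  gap q (INR p - h) = 0 -> h <= 4 * q ^ 2 * (ln q * q + 2 * taylor_const) * / q ^ p.
Proof.
intros hq Hp5 Hh HG; pose proof Hp5 as [Hp Hp2].
pose proof taylor_const_bounds as HA. pose proof (ln_pos q hq) as HL.
pose proof (qpow_inv_pos q hq p) as HE.
assert (Hsum : / q ^ 2 * phiR 2 (INR p - h) + (/ q ^ p * phiR p (INR p - h) + 0)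
  <= qsum q (fun i => phiR i (INR p - h))).
{ apply (qsum_ge_partial q taylor_const (2%nat :: p :: nil)%list (fun i => phiR i (INR p - h)) hq).
  - repeat constructor; simpl; intuition lia.
  - simpl; intuition lia.
  - intros; now apply phiR_bound.
  - intros; now apply phiR_nonneg. }
unfold gap in HG; rewrite exp_decay in HG by easy.
assert (H2 : h ^ 2 / 4 <= phiR 2 (INR p - h)).
{ apply phiR_2_lower; [now apply (prime_ge5_not_divides p 2 Hp5); lia | lra]. }
assert (Hpp : 1 - 2 * taylor_const * h ^ 2 <= phiR p (INR p - h)).
{ pose proof (phiR_taylor p (INR p) h ltac:(lia)) as HT.
  rewrite phiR'_eq_0, phiR_at_prime in HT by (easy || lia).
  unfold spike in HT; rewrite Nat.eqb_refl, (Rabs_pos_eq h) in HT by lra.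
  apply Rabs_le_between in HT.
  pose proof (phiR''_bound p (INR p) ltac:(lia)) as H3; apply Rabs_le_between in H3.
  assert (h ^ 3 <= h ^ 2) by nra. assert (0 < h ^ 2) by nra.
  assert (taylor_const * h ^ 3 <= taylor_const * h ^ 2) by nra.
  assert (h ^ 2 / 2 * - taylor_const <= h ^ 2 / 2 * phiR'' p (INR p))
    by (apply Rmult_le_compat_l; lra).
  nra. }
assert (Hexp : exp (h * ln q) - 1 <= h * (ln q * q)).
{ pose proof (exp_ineq1_le (- (h * ln q))) as He.
  pose proof (exp_pos (h * ln q)).
  assert (Hq : exp (h * ln q) <= q).
  { rewrite <- (exp_ln q) at 2 by lra.
    left; apply exp_increasing; nra. }
  assert (exp (h * ln q) * exp (- (h * ln q)) = 1)
    by (rewrite <- exp_plus, Rplus_opp_r; apply exp_0).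
  assert (0 < h * ln q) by nra. nra. }
pose proof (qpow_inv_pos q hq 2) as HQ.
assert (Hmain : / q ^ 2 * (h ^ 2 / 4) <= / q ^ p * (h * (ln q * q) + 2 * taylor_const * h ^ 2)).
{ assert (/ q ^ 2 * (h ^ 2 / 4) <= / q ^ 2 * phiR 2 (INR p - h))
    by (apply Rmult_le_compat_l; lra).
  assert (/ q ^ p * (1 - 2 * taylor_const * h ^ 2) <= / q ^ p * phiR p (INR p - h))
    by (apply Rmult_le_compat_l; lra).
  assert (/ q ^ p * (exp (h * ln q) - 1) <= / q ^ p * (h * (ln q * q)))
    by (apply Rmult_le_compat_l; lra).
  lra. }
apply Rmult_le_reg_l with (h * (/ q ^ 2 / 4)); [nra|].
replace (h * (/ q ^ 2 / 4) * (4 * q ^ 2 * (ln q * q + 2 * taylor_const) * / q ^ p))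
  with (/ q ^ p * (h * (ln q * q) + 2 * taylor_const * h))
  by (field; split; [apply Rgt_not_eq, pow_lt; lra | lra]).
replace (h * (/ q ^ 2 / 4) * h) with (/ q ^ 2 * (h ^ 2 / 4)) by (unfold Rdiv; ring).
eapply Rle_trans; [exact Hmain|].
apply Rmult_le_compat_l; [lra|].
assert (taylor_const * h ^ 2 <= taylor_const * h) by (apply Rmult_le_compat_l; nra). lra.
Qed.

(** Division of the expansion by h, with the terms of order h^2 collected into K. *)
Lemma zero_second_order (q : R) (p : nat) (h : R) : 1 < q -> prime_ge5 p -> 0 < h < 1 ->
  gap q (INR p - h) = 0 ->
  Rabs (K_re q p * h - / q ^ p * ln q) <= (ln q ^ 3 * q + taylor_const * total_weight q) * h ^ 2.
Proof.
intros hq [Hp Hp5] Hh HG.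
pose proof (gap_expansion q p h hq Hp ltac:(lia)) as HT. rewrite HG in HT.
rewrite (Rabs_pos_eq h) in HT by lra. apply Rabs_le_between in HT.
pose proof (ln_pos q hq) as HL. pose proof (qpow_inv_pos q hq p) as HE.
assert (HE1 : / q ^ p <= 1).
{ rewrite <- Rinv_1; apply Rinv_le_contravar; [lra|]. apply pow_R1_Rle; lra. }
assert (Ht : 0 <= h * ln q) by nra.
pose proof (exp_taylor (h * ln q) Ht) as He.
assert (Hq : exp (h * ln q) <= q).
{ rewrite <- (exp_ln q) at 2 by lra. left; apply exp_increasing; nra. }
set (r := exp (h * ln q) - 1 - h * ln q - (h * ln q) ^ 2 / 2) in *.
assert (Hr : 0 <= r <= ln q ^ 3 * q * h ^ 3).
{ split; [lra|]. replace (ln q ^ 3 * q * h ^ 3) with ((h * ln q) ^ 3 * q) by ring.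
  eapply Rle_trans; [apply He|]. apply Rmult_le_compat_l; [now apply pow_le | lra]. }
assert (HEr : 0 <= / q ^ p * r <= r) by nra.
assert (HK : h * (K_re q p * h - / q ^ p * ln q)
  = h ^ 2 / 2 * qsum q (fun i => phiR'' i (INR p)) - / q ^ p * (exp (h * ln q) - 1)
    + / q ^ p * r).
{ unfold K_re, r. field. apply Rgt_not_eq, pow_lt; lra. }
pose proof taylor_const_bounds. pose proof (total_weight_pos q hq).
assert (0 < taylor_const * total_weight q) by nra.
apply Rmult_le_reg_l with h; [lra|].
rewrite <- (Rabs_pos_eq h) at 1 by lra. rewrite <- Rabs_mult, HK.
replace (h * ((ln q ^ 3 * q + taylor_const * total_weight q) * h ^ 2))
  with (ln q ^ 3 * q * h ^ 3 + taylor_const * total_weight q * h ^ 3) by ring.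
apply Rabs_le; lra.
Qed.

Lemma zero_exists (q : R) (p : nat) : 1 < q -> prime_ge5 p ->
  exists x, INR p - 1 < x < INR p /\ gap q x = 0.
Proof.
intros hq Hp5; pose proof Hp5 as [Hp Hp2].
pose proof taylor_const_bounds. pose proof (total_weight_pos q hq). pose proof (ln_pos q hq).
pose proof (qpow_inv_pos q hq p).
assert (HL : 0 < / q ^ p * ln q) by nra. assert (HC : 0 < 2 * taylor_const * total_weight q) by nra.
(* Small enough for the linear term to dominate the bound of [gap_upper], and less
   than 1. *)
set (h := / q ^ p * ln q / (2 * taylor_const * total_weight q + / q ^ p * ln q + 1)).
assert (Hh : 0 < h < 1).
{ split; [apply Rdiv_lt_0_compat; lra | apply Rlt_div_l; lra]. }
assert (Hneg : gap q (INR p - h) < 0).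
{ eapply Rle_lt_trans; [now apply gap_upper|].
  enough (2 * taylor_const * total_weight q * h < / q ^ p * ln q) by nra.
  unfold h, Rdiv; rewrite <- Rmult_assoc; apply Rlt_div_l; nra. }
assert (Hint : INR p - 1 = INR (p - 1)) by (now rewrite minus_INR by lia).
assert (Hpos : 0 < gap q (INR p - 1)).
{ rewrite Hint; unfold gap.
  replace (- INR (p - 1)) with (- (INR (p - 1) - 0)) by ring.
  rewrite exp_decay, Rmult_0_l, exp_0 by easy.
  assert (Heven : (2 | Z.of_nat (p - 1))%Z).
  { destruct (Z.Even_or_Odd (Z.of_nat p)) as [[m Hm]|[m Hm]].
    - exfalso; apply (prime_ge5_not_divides p 2 Hp5); [lia|]. exists m; lia.
    - exists m; lia. }
  pose proof (qsum_ge_partial q taylor_const (2%nat :: (p - 1)%nat :: nil)%list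
    (fun i => phiR i (INR (p - 1))) hq) as Hs.
  simpl List.fold_right in Hs; cbv beta in Hs.
  rewrite 2!phiR_eq_1 in Hs; try lia.
  2: { apply cos_freq_divides; [lia | exists 1%Z; lia]. }
  2: { apply cos_freq_divides; [lia | exact Heven]. }
  pose proof (qpow_inv_pos q hq 2).
  enough (/ q ^ 2 * 1 + (/ q ^ (p - 1) * 1 + 0) <= qsum q (fun i => phiR i (INR (p - 1))))
    by lra.
  apply Hs.
  - repeat constructor; simpl; intuition lia.
  - simpl; intuition lia.
  - intros; now apply phiR_bound.
  - intros; now apply phiR_nonneg. }
destruct (IVT_cor (gap q) (INR p - 1) (INR p - h)) as [x [Hx HGx]].
- now apply gap_continuous.
- lra.
- nra.
- exists x; split; [| easy].
  destruct (Req_dec x (INR p - 1)) as [->|]; lra.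
Qed.

Theorem proposition4p5 (q : R) (hq : 1 < q) :
  (forall p : nat, prime_ge5 p -> exists x : R, left_zero q p x) /\
  (exists M : R, 0 < M /\
     forall (p : nat) (x : R), prime_ge5 p -> left_zero q p x ->
       K q p <> RtoC 0 /\
       exists eps : R, Rabs eps <= M * / q ^ p /\
         RtoC (Delta_p p x)
         = (RtoC (ln q) / K q p * RtoC (/ q ^ p) * RtoC (1 + eps))%C) /\
  (exists c1 c2 : R, 0 < c1 /\ 0 < c2 /\
     forall (p : nat) (x : R), prime_ge5 p -> left_zero q p x ->
       c1 * / q ^ p <= Delta_p p x <= c2 * / q ^ p) /\
  (forall (p : nat) (x : R), prime_ge5 p -> left_zero q p x ->
     x = INR p - Delta_p p x /\ x < INR p).
Proof.
pose proof taylor_const_bounds. pose proof (total_weight_pos q hq). pose proof (ln_pos q hq) as HL.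
set (c2 := 4 * q ^ 2 * (ln q * q + 2 * taylor_const)).
set (B := ln q ^ 3 * q + taylor_const * total_weight q).
assert (Hc2 : 0 < c2) by (unfold c2; repeat apply Rmult_lt_0_compat; nra).
assert (HB : 0 < B).
{ unfold B; pose proof (pow_lt (ln q) 3 HL); nra. }
assert (Hzero : forall p x, left_zero q p x ->
  0 < Delta_p p x < 1 /\ gap q (INR p - Delta_p p x) = 0).
{ intros p x Hx; apply left_zero_iff in Hx; [| easy]. unfold Delta_p.
  replace (INR p - (INR p - x)) with x by ring. split; [lra | easy]. }
assert (Hup : forall p x, prime_ge5 p -> left_zero q p x -> Delta_p p x <= c2 * / q ^ p).
{ intros p x Hp Hx; destruct (Hzero p x Hx). now apply zero_upper. }
split; [| split; [| split]].
- intros p Hp; destruct (zero_exists q p hq Hp) as [x Hx].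
  exists x; now apply left_zero_iff.
- exists (B * c2 ^ 2 / ln q). split.
  { apply Rdiv_lt_0_compat; [| easy]. apply Rmult_lt_0_compat; [easy | now apply pow_lt]. }
  intros p x Hp Hx. destruct (Hzero p x Hx) as [Hh HG].
  pose proof (Hup p x Hp Hx) as Hhu.
  pose proof (K_re_pos q p hq Hp) as HK. pose proof (qpow_inv_pos q hq p) as HE.
  pose proof (zero_second_order q p _ hq Hp Hh HG) as HT; fold B in HT.
  set (h := Delta_p p x) in *. set (E := / q ^ p) in *.
  rewrite K_real. split; [intros Hk; apply RtoC_inj in Hk; lra|].
  (* The value of eps for which the formula holds with equality. *)
  exists (K_re q p * h / (E * ln q) - 1). split.
  + assert (HEL : 0 < E * ln q) by nra.
    replace (K_re q p * h / (E * ln q) - 1) with ((K_re q p * h - E * ln q) / (E * ln q))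
      by (field; lra).
    unfold Rdiv; rewrite Rabs_mult, (Rabs_pos_eq (/ _))
      by (left; now apply Rinv_0_lt_compat).
    apply Rle_div_l; [easy|]. eapply Rle_trans; [exact HT|].
    replace (B * c2 ^ 2 * / ln q * E * (E * ln q)) with (B * (c2 * E) ^ 2) by (field; lra).
    apply Rmult_le_compat_l; [lra|]. apply pow_incr; lra.
  + rewrite <- RtoC_div, <- 2!RtoC_mult by lra. f_equal. field. lra.
- exists (ln q / (2 * taylor_const * total_weight q)), c2.
  split; [apply Rdiv_lt_0_compat; nra|]. split; [easy|].
  intros p x Hp Hx; split; [| now apply Hup].
  destruct (Hzero p x Hx) as [Hh HG].
  pose proof (gap_upper q p _ hq Hp Hh) as H1. rewrite HG in H1.
  set (h := Delta_p p x) in *.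
  replace (ln q / (2 * taylor_const * total_weight q) * / q ^ p)
    with (/ q ^ p * ln q / (2 * taylor_const * total_weight q))
    by (unfold Rdiv; ring).
  apply Rle_div_l; [nra|].
  apply Rmult_le_reg_r with h; [lra|]. lra.
- intros p x Hp Hx; apply Hzero in Hx as [Hh _]; unfold Delta_p in *; lra.
Qed.
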